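(* Let $E=\mathbb{Z}\times\mathbb{Z}_2$ be the square lattice of width $2$. Let $m\in\{0,1,2,3\}$ and let $\mathcal{A}=(A_1,A_2,\dots,A_{m+1})$ be any collective of compassless automata of type $(1,m)$ on $E$ (one automaton $A_1$ and $m$ pebbles $A_2,\dots,A_{m+1}$). Then the movement of $\mathcal{A}$ on $E$ is not directed; that is, there exists an implementation of the behaviour $\Pi(\mathcal{A},E)$ in which the movement of $\mathcal{A}$ is not directed. In particular this holds for: (1) a collective consisting of a single automaton; (2) a collective of an automaton and one pebble; (3) a collective of one automaton and two pebbles; (4) a collective of one automaton and three pebbles.
   Context: Environment: $E=\mathbb{Z}\times\mathbb{Z}_2$, where $\mathbb{Z}_2=\{0,1\}$. Two vertices of $E$ are neighbours if they differ by exactly $1$ in exactly one coordinate and agree in the other; the neighbourhood of a vertex is the set of its neighbours (each vertex has exactly three neighbours). A collective $\mathcal{A}=(A_1,\dots,A_{m+1})$ with member set $M$ consists of finite automata moving on the vertices of $E$. Each $A_i=(Q_i,X_i,Y_i,q_i^0,\varphi_i,\psi_i)$ has a finite state set $Q_i$, initial state $q_i^0$, input alphabet $X_i=\{(\alpha,\{\beta,\gamma,\delta\}) : \alpha,\beta,\gamma,\delta\subseteq M\}$ (where $\alpha$ is the set of members at the current vertex and the unordered multiset $\{\beta,\gamma,\delta\}$ lists the sets of members at the three neighbouring vertices), output alphabet $Y_i=\mathcal{P}(M)\cup\{\mathrm{stay}\}$, transition function $\varphi_i:Q_i\times X_i\to Q_i$ and output function $\psi_i:Q_i\times X_i\to Y_i$.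 Output $\mathrm{stay}$ means stay at the current vertex; output $\varnothing$ means move to some neighbouring vertex containing no members (chosen non-deterministically if there are several); output $y\notin\{\varnothing,\mathrm{stay}\}$ means move to the neighbouring vertex containing exactly the members in $y$. Thus automata are compassless: they distinguish neighbouring vertices only by which members occupy them, not by coordinates or direction; members are mutually distinguishable. A collective of type $(1,m)$ consists of one automaton $A_1$ and $m$ pebbles $A_2,\dots,A_{m+1}$, where each pebble $A_j$ has a single state and can move only if $A_1$ is at the same vertex, and then only to the same vertex to which $A_1$ moves (formally: for every input $x$, either $\psi_j(q_j^0,x)=\mathrm{stay}$, or $\psi_j(q_j^0,x)=y\neq\mathrm{stay}$, in which case $A_1\in\alpha$ and $\psi_1(q,x)=y$ for some $q\in Q_1$). The behaviour $\Pi(\mathcal{A},E)$ is the set of all (non-deterministic) runs $(\vec x_t,\vec q_t,\vec y_t)_{t\ge 0}$ obeying $q^j_{t+1}=\varphi_j(q^j_t,x^j_t)$, $y^j_{t+1}=\psi_j(q^j_t,x^j_t)$; each run is an implementation. If $v_i(t)\in E$ is the position of $A_i$ at time $t$, the coordinate of the collective is $v_{\mathcal{A}}(t)=(v_1(t)+\dots+v_{m+1}(t))/(m+1)$, and its diameter is the maximum over all pairs of members and over both coordinates of the absolute difference of their coordinates. The movement of $\mathcal{A}$ in an implementation is directed if there are constants $c_1,c_2\in\mathbb{N}$ such that the diameter is always at most $c_1$ and for every time $t$ there exist natural numbers $t',t''\le c_2$ with $v_{\mathcal{A}}(t+t')-v_{\mathcal{A}}(t)=v_{\mathcal{A}}(t+t'+t'')-v_{\mathcal{A}}(t+t')$.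 The movement of $\mathcal{A}$ is called directed if it is directed in all implementations of $\Pi(\mathcal{A},E)$; otherwise it is not directed.
   Formalization: Directed movement here also requires the repeated displacement of the coordinate to be nonzero and the coordinate to leave every bounded region; as literally defined, a collective that always stays is directed, so the claim would be false. *)

(* Defs.v *)
From HB Require Import structures.
From mathcomp Require Import all_boot all_order all_algebra.
From mathcomp Require Import finmap multiset zify.

Set Implicit Arguments.
Unset Strict Implicit.
Unset Printing Implicit Defensive.

Import Order.TTheory GRing.Theory Num.Theory.

Local Open Scope ring_scope.
Local Open Scope mset_scope.

(* The square lattice Z x Z_2 of width 2, the second coordinate being 0 or 1. *)
Definition vertex : Type := int * 'I_2.

Definition adjacent (u v : vertex) : bool :=
  ((`|u.1 - v.1|%N == 1%N) && (u.2 == v.2))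
  || ((u.1 == v.1) && (`|(u.2 : nat)%:Z - (v.2 : nat)%:Z|%N == 1%N)).

Definition neighbours (v : vertex) : seq vertex :=
  [:: (v.1 - 1, v.2); (v.1 + 1, v.2); (v.1, rev_ord v.2)].

Lemma mem_neighbours (v w : vertex) : (w \in neighbours v) = adjacent v w.
Proof.
case: v w => [x a] [y b]; rewrite !inE /adjacent /= !xpair_eqE /=.
by move: a b => [[|[|a]] Ha] [[|[|b]] Hb] //; rewrite -!val_eqE /=; lia.
Qed.

Lemma uniq_neighbours (v : vertex) : uniq (neighbours v).
Proof.
by case: v => x [[|[|a]] Ha] //=; rewrite !inE !xpair_eqE -!val_eqE /=; lia.
Qed.

Section Automata.

Variable M : finType.

(* (alpha, {beta, gamma, delta}), the second component an unordered multiset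
   of three sets of members. *)
Definition input : Type :=
  {x : {set M} * {mset {set M}} | size x.2 == 3%N}.

Definition members_here (x : input) : {set M} := (val x).1.

(* [None] is the output "stay"; [Some y] asks to move to a neighbouring vertex
   whose set of members is exactly [y], in particular [Some set0] to a
   neighbouring vertex without members. *)
Definition output : Type := option {set M}.

Record automaton := Automaton {
  state : finType;
  init : state;
  trans : state -> input -> state;
  out : state -> input -> output }.

Definition occupants (p : M -> vertex) (v : vertex) : {set M} :=
  [set i | p i == v].

Lemma view_subproof (p : M -> vertex) (v : vertex) :
  size (seq_mset [seq occupants p w | w <- neighbours v]) == 3%N.
Proof. by rewrite (perm_size (perm_eq_seq_mset _)). Qed.

Definition view (p : M -> vertex) (v : vertex) : input :=
  exist (fun x : {set M} * {mset {set M}} => size x.2 == 3%N)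
    (occupants p v, seq_mset [seq occupants p w | w <- neighbours v])
    (view_subproof p v).

(* [w] is a possible next position of a member standing at [v] whose output is
   [y].  A request for a neighbouring vertex that does not exist leaves the
   member in place, so that every configuration has a successor. *)
Definition obeys (p : M -> vertex) (v : vertex) (y : output) (w : vertex) :
    bool :=
  if y is Some s then
    if has (fun u => occupants p u == s) (neighbours v)
    then (w \in neighbours v) && (occupants p w == s)
    else w == v
  else w == v.

End Automata.

(* Members are indexed by 'I_m.+1; index [ord0] is the automaton A_1 and the
   other indices are the pebbles. *)
Definition collective (m : nat) : Type := 'I_m.+1 -> automaton 'I_m.+1.

Definition config (m : nat) : Type := 'I_m.+1 -> vertex.

Definition type1 (m : nat) (A : collective m) : Prop :=
  forall j : 'I_m.+1, j != ord0 ->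
    #|state (A j)| = 1%N /\
    forall (x : input 'I_m.+1) (y : {set 'I_m.+1}),
      out (init (A j)) x = Some y ->
      ord0 \in members_here x /\
      exists q : state (A ord0), out q x = Some y.

Record run (m : nat) (A : collective m) := Run {
  pos : nat -> config m;
  st : nat -> forall i : 'I_m.+1, state (A i) }.

Section Behaviour.

Variables (m : nat) (A : collective m).

Definition input_at (r : run A) (t : nat) (i : 'I_m.+1) : input 'I_m.+1 :=
  view (pos r t) (pos r t i).

Definition output_at (r : run A) (t : nat) (i : 'I_m.+1) : output 'I_m.+1 :=
  out (st r t i) (input_at r t i).

(* The third clause expresses that a pebble moves only together with A_1, to
   the very vertex to which A_1 moves: the output of a pebble has one state to
   depend on, so it may name a destination which A_1, in its current state, does
   not choose, and in that case the pebble stays.  When the two outputs agree,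
   [type1] puts the pebble and A_1 on the same vertex. *)
Definition step (r : run A) (t : nat) : Prop :=
  [/\ forall i, st r t.+1 i = trans (st r t i) (input_at r t i),
      obeys (pos r t) (pos r t ord0) (output_at r t ord0) (pos r t.+1 ord0)
    & forall j, j != ord0 ->
        pos r t.+1 j =
          if (output_at r t j != None) && (output_at r t j == output_at r t ord0)
          then pos r t.+1 ord0 else pos r t j].

(* The behaviour of A on the lattice, from the initial placement [p0]. *)
Definition implementation (p0 : config m) (r : run A) : Prop :=
  [/\ pos r 0%N =1 p0, forall i, st r 0%N i = init (A i)
    & forall t, step r t].

End Behaviour.

Definition coordinate (m : nat) (p : config m) : rat * rat :=
  ((\sum_(i < m.+1) (p i).1%:~R) / m.+1%:R,
   (\sum_(i < m.+1) (p i).2%:R) / m.+1%:R).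

Definition diameter (m : nat) (p : config m) : nat :=
  \max_(i < m.+1) \max_(j < m.+1)
    maxn `|(p i).1 - (p j).1|%N
         `|((p i).2 : nat)%:Z - ((p j).2 : nat)%:Z|%N.

(* The first two clauses are the bounded diameter and the repetition of a
   displacement within bounded time.  The repetition alone is satisfied by
   bounded movements (by a collective which never moves, if the displacement
   may be zero, and by walking to and fro between positions 0 and 3 of a line
   if it may not), so a directed movement is also required to leave every
   bounded region; the second coordinate being bounded, this is a condition on
   the first one. *)
Definition directed (m : nat) (p : nat -> config m) : Prop :=
  let v t := coordinate (p t) in
  exists c1 c2 : nat,
  [/\ forall t, (diameter (p t) <= c1)%N,
      forall t, exists t' t'' : nat,
        [/\ (t' <= c2)%N, (t'' <= c2)%N,
            v (t + t')%N - v t = v (t + t' + t'')%N - v (t + t')%N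
          & v (t + t')%N - v t != 0]
    & forall b : nat, exists t, b%:R < `|(v t).1 - (v 0%N).1|].

(* Main.v *)
(** Whatever A_1 does, the non-determinism can keep the collective in a bounded
    region.  When A_1 has a choice, it is sent towards column 0 if possible,
    else across, else away from column 0; hence it moves across to an empty
    vertex only if a pebble blocks the way in, and outward to an empty vertex
    only if two pebbles block the way in and the way across.  A pebble is
    therefore carried outward to an empty vertex only if all three pebbles are
    close together.  Confinement to the columns [-N, N] is preserved together
    with the following property, which excludes this in the extreme columns:
    if distinct pebbles i, j, k have dist(i, j) <= 1 and dist(i, k) <= 2, then
    i is not in column N or -N.  This holds for every behaviour of A_1, finite
    state or not, and even if A_1 could jump between pebbles. *)
Require Import Defs.
From mathcomp Require Import all_boot.
From mathcomp Require Import all_order all_algebra zify.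

Set Implicit Arguments.
Unset Strict Implicit.
Unset Printing Implicit Defensive.

Import Order.TTheory GRing.Theory Num.Theory.

Local Open Scope ring_scope.

(** * Distance and directions on the lattice *)

Definition vdist (u v : vertex) : nat :=
  (`|u.1 - v.1| + `|(u.2 : nat)%:Z - (v.2 : nat)%:Z|)%N.

(** Column 0 has no inward direction; column 1 is chosen there by convention. *)
Definition inward (v : vertex) : vertex :=
  (if v.1 <= 0 then v.1 + 1 else v.1 - 1, v.2).
Definition across (v : vertex) : vertex := (v.1, rev_ord v.2).
Definition outward (v : vertex) : vertex :=
  (if v.1 <= 0 then v.1 - 1 else v.1 + 1, v.2).

Local Open Scope nat_scope.

Lemma mem_candidates (v : vertex) :
  [:: inward v; across v; outward v] =i neighbours v.
Proof.
move=> w; rewrite !inE /inward /across /outward.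
case: ifP => _; first by rewrite orbA orbC.
by rewrite [(w == (v.1, rev_ord _)) || _]orbC.
Qed.

Lemma vdist0P (u v : vertex) : reflect (u = v) (vdist u v == 0).
Proof.
apply: (iffP eqP) => [|->]; last by rewrite /vdist; lia.
case: u v => [x a] [y b]; rewrite /vdist /= => E.
by congr (_, _); [|apply: val_inj => /=]; lia.
Qed.

(** Since [N] exceeds 4, [v] lies on the same side of column 0 as [r] and no further out, so an
    inward step leads away from [r]. *)
Lemma vdist_inward r v N : 4 < N -> N <= `|r.1| -> `|v.1| <= N ->
  vdist r (inward v) <= 2 -> vdist r v < vdist r (inward v).
Proof. by rewrite /vdist /inward /=; case: ifP; lia. Qed.

Lemma vdistC u v : vdist u v = vdist v u.
Proof. by rewrite /vdist; lia. Qed.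

Lemma vdistvv v : vdist v v = 0.
Proof. by rewrite /vdist; lia. Qed.

Lemma vdist_triangle u v w : vdist u w <= vdist u v + vdist v w.
Proof. by rewrite /vdist; lia. Qed.

(** * Guided moves preserve confinement *)

Section Patrol.

Variable m : nat.
Implicit Types (p : config m) (i j k l : 'I_m.+1) (v w : vertex).

Definition pebbled p w := exists2 l, l != ord0 & p l = w.

(* A_1 moves from v to w by the rule of the header: w carries a pebble or is
   the first empty vertex among inward, across, outward. *)
Definition guided p v w :=
  [\/ pebbled p w /\ vdist v w = 1, w = inward v,
      pebbled p (inward v) /\ w = across v
    | [/\ pebbled p (inward v), pebbled p (across v) & w = outward v] ].

Definition carries p p' v w :=
  forall j, j != ord0 -> p' j = p j \/ p j = v /\ p' j = w.

Lemma pebbles_neq0 i j k : uniq [:: ord0; i; j; k] ->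
  [/\ i != ord0, j != ord0 & k != ord0].
Proof. by rewrite /= !inE -!val_eqE /=; split; lia. Qed.

Lemma pebbles_swap12 i j k :
  uniq [:: ord0; i; j; k] -> uniq [:: ord0; j; i; k].
Proof. by rewrite /= !inE -!val_eqE /=; lia. Qed.

Lemma pebbles_swap23 i j k :
  uniq [:: ord0; i; j; k] -> uniq [:: ord0; i; k; j].
Proof. by rewrite /= !inE -!val_eqE /=; lia. Qed.

Lemma carries_fixed p p' v w u l :
  carries p p' v w -> l != ord0 -> p l = u -> 0 < vdist v u -> p' l = u.
Proof. by move=> mv /mv[->//|[-> ->]] <-; rewrite vdistvv. Qed.

Variable N : nat.

(* A_1 may stand one column further out than the pebbles. *)
Definition confined p : Prop :=
  [/\ `|(p ord0).1| <= N.+1,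
      forall i, i != ord0 -> `|(p i).1| <= N
    & forall i j k, uniq [:: ord0; i; j; k] ->
        vdist (p i) (p j) <= 1 -> vdist (p i) (p k) <= 2 -> `|(p i).1| < N].

Hypotheses (m3 : m <= 3) (N4 : 4 < N).

(** Here [m <= 3] enters: three distinct pebbles are all the pebbles. *)
Lemma three_pebbles i j k l :
  uniq [:: ord0; i; j; k] -> l != ord0 -> l = i \/ l = j \/ l = k.
Proof.
have := (ltn_ord i, ltn_ord j, ltn_ord k, ltn_ord l).
rewrite /= !inE -!val_eqE /= => -[[[]]] *.
have : l = i :> nat \/ l = j :> nat \/ l = k :> nat by lia.
by case=> [/val_inj|[]/val_inj]; auto.
Qed.

(* In the lemmas on crowds, a pebble p' i in an extreme column with the other
   two close to it is traced back to such a crowd, possibly around another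
   pebble, before the move. *)
Lemma crowd_inward p p' v i j k :
  confined p -> carries p p' v (inward v) -> `|v.1| <= N ->
  uniq [:: ord0; i; j; k] ->
  vdist (p' i) (p' j) <= 1 -> vdist (p' i) (p' k) <= 2 -> `|(p' i).1| < N.
Proof.
move=> [_ _ cp] mv vN U ij ik; rewrite ltnNge; apply/negP=> iN.
have [i0 j0 k0] := pebbles_neq0 U.
have Ei : p' i = p i.
  case: (mv i i0) => // -[_ E]; move: iN vN; rewrite E /inward /=.
  by case: ifP; lia.
rewrite Ei in iN ij ik.
(* A pebble carried inward was nearer to [p i] before the move, so the old triple was a crowd as
   well. *)
have close l d : l != ord0 -> d <= 2 ->
    vdist (p i) (p' l) <= d -> vdist (p i) (p l) <= d.
  move=> l0 d2; case: (mv l l0) => [->//|[-> ->]] H.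
  by apply/ltnW/(leq_trans _ H); apply: vdist_inward vN (leq_trans H d2).
have := cp i j k U (close j 1 j0 isT ij) (close k 2 k0 isT ik).
by rewrite ltnNge iN.
Qed.

(** The pebble on [w] stays, and one carried onto it came from distance 1. The old crowd is around
    [i] if [i] was not carried, and otherwise around the pebble on [w], where [i] ends up. *)
Lemma crowd_onto_pebble p p' v w i j k :
  confined p -> carries p p' v w ->
  pebbled p w -> vdist v w = 1 -> uniq [:: ord0; i; j; k] ->
  vdist (p' i) (p' j) <= 1 -> vdist (p' i) (p' k) <= 2 -> `|(p' i).1| < N.
Proof.
move=> [_ _ cp] mv [l l0 lw] vw U ij ik.
have [i0 j0 k0] := pebbles_neq0 U.
have lw' : p' l = w by apply: carries_fixed mv l0 lw _; rewrite vw.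
have close x d : x != ord0 -> 0 < d ->
    vdist w (p' x) <= d -> vdist w (p x) <= d.
  move=> x0 d0; case: (mv x x0) => [->//|[-> _]].
  by rewrite [vdist w v]vdistC vw.
have [El|[El|El]] := three_pebbles U l0; subst l.
- rewrite lw' in ij ik *; rewrite -lw.
  by apply: cp U _ _; rewrite lw; apply: close.
- rewrite lw' in ij.
  case: (mv i i0) => [Ei|[Ev Ei]]; rewrite Ei in ij ik *.
    case: (mv k k0) => [Ek|[Ek _]].
      by rewrite Ek in ik; apply: cp U _ _; rewrite ?lw.
    apply: cp U _ _; rewrite ?lw // Ek.
    apply: leq_trans (vdist_triangle _ w _) _.
    by rewrite [vdist w v]vdistC vw addn1.
  rewrite -lw; apply: cp (pebbles_swap12 U) _ _; rewrite lw ?Ev.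
    by rewrite vdistC vw.
  exact: close.
rewrite lw' in ik.
case: (mv i i0) => [Ei|[Ev Ei]]; rewrite Ei in ij ik *.
  case: (mv j j0) => [Ej|[Ev Ej]]; rewrite Ej in ij.
    by apply: cp U _ _; rewrite ?lw.
  apply: cp (pebbles_swap23 U) _ _; rewrite ?lw // Ev.
  apply: leq_trans (vdist_triangle _ w _) _.
  by rewrite [vdist w v]vdistC vw addn1.
have Ukji := pebbles_swap12 (pebbles_swap23 (pebbles_swap12 U)).
rewrite -lw; apply: cp Ukji _ _; rewrite lw ?Ev; first exact: close.
by rewrite vdistC vw.
Qed.

(** A pebble rests on [inward v], not an extreme column, so it is [j] or [k]. If [i] stays, [v] is
    nearer to it than [inward v] is; if [i] is carried, it keeps its column and came from a vertex
    next to [inward v]. Either way [i] was the centre of an old crowd. *)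
Lemma crowd_across p p' v i j k :
  confined p -> carries p p' v (across v) -> `|v.1| <= N ->
  pebbled p (inward v) -> uniq [:: ord0; i; j; k] ->
  vdist (p' i) (p' j) <= 1 -> vdist (p' i) (p' k) <= 2 -> `|(p' i).1| < N.
Proof.
move=> [_ _ cp] mv vN [l l0 lu] U ij ik; rewrite ltnNge; apply/negP=> iN.
have [i0 j0 k0] := pebbles_neq0 U.
have lu' : p' l = inward v.
  by apply: carries_fixed mv l0 lu _; rewrite /vdist /inward /=; case: ifP; lia.
have [El|[El|El]] := three_pebbles U l0; subst l.
- by move: iN vN; rewrite lu' /inward /=; case: ifP; lia.
(* A carried [i] would be on [across v], at distance 2 from [j] on [inward v]. *)
- case: (mv i i0) => [Ei|[Ev Ei]]; last first.
    move: ij; rewrite Ei lu' /vdist /inward /across /=.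
    by have := ltn_ord v.2; case: ifP; lia.
  rewrite lu' Ei in ij; rewrite Ei in ik iN.
  have Ev : p i = v.
    apply/vdist0P; rewrite -leqn0 -ltnS; apply: (leq_trans _ ij).
    exact: vdist_inward vN (leqW ij).
  case: (mv k k0) => [Ek|[Ek _]].
    rewrite Ek in ik; have := cp i j k U.
    by rewrite lu ltnNge iN ij ik => /(_ isT isT).
  have := cp i j k U.
  by rewrite lu ltnNge iN ij Ev Ek vdistvv => /(_ isT isT).
rewrite lu' in ik.
case: (mv i i0) => [Ei|[Ev Ei]]; rewrite Ei in ij ik iN.
  have : vdist (p i) (p j) <= 1.
    case: (mv j j0) => [Ej|[-> _]]; first by rewrite -Ej.
    by rewrite -ltnS; apply: (leq_trans _ ik); apply: vdist_inward vN ik.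
  by move/(cp i j k U); rewrite lu ik ltnNge iN => /(_ isT).
have va : vdist v (across v) <= 1.
  by rewrite /vdist /across /=; have := ltn_ord v.2; lia.
have vk : vdist (p i) (p k) <= 1.
  by rewrite Ev lu /vdist /inward /=; case: ifP; lia.
have vj : vdist (p i) (p j) <= 2.
  rewrite Ev; case: (mv j j0) => [Ej|[-> _]]; last by rewrite vdistvv.
  apply: leq_trans (vdist_triangle v (across v) (p j)) _.
  by rewrite -Ej (leq_add va ij).
have := cp i k j (pebbles_swap23 U) vk vj.
by rewrite Ev ltnNge iN.
Qed.

(** The pebbles on [v], [inward v] and [across v] form a crowd around [v], so [v] is not in an
    extreme column. A pebble carried to [outward v] is at distance at least 2 from both others and
    is no centre. *)
Lemma crowd_outward p p' v i j k l :
  confined p -> carries p p' v (outward v) -> `|v.1| <= N ->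
  pebbled p (inward v) -> pebbled p (across v) ->
  l != ord0 -> p l = v ->
  `|v.1| < N /\
  (uniq [:: ord0; i; j; k] ->
   vdist (p' i) (p' j) <= 1 -> vdist (p' i) (p' k) <= 2 -> `|(p' i).1| < N).
Proof.
move=> [_ _ cp] mv vN [a a0 au] [b b0 bt] l0 lv.
have [dva dvb dab] : [/\ vdist v (inward v) = 1, vdist v (across v) = 1
    & vdist (inward v) (across v) = 2].
  rewrite /vdist /inward /across /=.
  by have := ltn_ord v.2; case: ifP; split; lia.
have [dao dbo] : vdist (inward v) (outward v) = 2
    /\ vdist (across v) (outward v) = 2.
  rewrite /vdist /inward /across /outward /=.
  by have := ltn_ord v.2; case: ifP; split; lia.
have au' : p' a = inward v by apply: carries_fixed mv a0 au _; rewrite dva.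
have bt' : p' b = across v by apply: carries_fixed mv b0 bt _; rewrite dvb.
have Ul : uniq [:: ord0; l; a; b].
  rewrite /= !inE !negb_or !andbT ![ord0 == _]eq_sym l0 a0 b0 /=.
  apply/andP; split; [apply/andP; split|]; apply/eqP => E.
  - by move: dva; rewrite -au -E lv vdistvv.
  - by move: dvb; rewrite -bt -E lv vdistvv.
  by move: dab; rewrite -au -bt E vdistvv.
have vN' : `|v.1| < N.
  by rewrite -lv; apply: cp Ul _ _; rewrite lv ?au ?bt ?dva ?dvb.
split=> // U ij ik.
have [i0 j0 k0] := pebbles_neq0 U.
have [El|[El|El]] := three_pebbles Ul i0; subst i.
- case: (mv l l0) => [->|[_ El]]; first by rewrite lv.
  rewrite El in ij.
  have [Ej|[Ej|Ej]] := three_pebbles Ul j0; subst j.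
  + by move: U; rewrite /= !inE eqxx /= andbF.
  + by move: ij; rewrite au' vdistC dao.
  by move: ij; rewrite bt' vdistC dbo.
- by rewrite au' /inward /=; case: ifP; lia.
by rewrite bt'.
Qed.

Lemma confined_step p p' w :
  confined p -> guided p (p ord0) w -> p' ord0 = w ->
  carries p p' (p ord0) w -> confined p'.
Proof.
move=> Cp; have [a1 bp cp] := Cp.
move: (p ord0) a1 => v a1 gw p0w mv.
have [l /andP[l0 /eqP lv]|none] :=
  pickP [pred l | (l != ord0) && (p l == v)]; last first.
  have fixed i : i != ord0 -> p' i = p i.
    move=> i0; case: (mv i i0) => // -[/eqP E _].
    by have := none i; rewrite /= i0 E.
  split=> [|i i0|i j k U]; last first.
  + by have [i0 j0 k0] := pebbles_neq0 U; rewrite !fixed //; apply: cp.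
  + by rewrite fixed //; apply: bp.
  (* Without a pebble on [v], [A_1] goes outward only if a pebble is on [across v], hence from a
     column within [N]; this gives the bound [N.+1]. *)
  rewrite p0w; case: gw => [[[x x0 <-] _]|->|[_ ->]|[_ [x x0 xv] ->]].
  + by have := bp x x0; lia.
  + by rewrite /inward /=; case: ifP; lia.
  + by [].
  by have := bp x x0; rewrite xv /outward /=; case: ifP; lia.
have vN : `|v.1| <= N by rewrite -lv bp.
have [wN cp'] : `|w.1| <= N /\ forall i j k, uniq [:: ord0; i; j; k] ->
    vdist (p' i) (p' j) <= 1 -> vdist (p' i) (p' k) <= 2 ->
    `|(p' i).1| < N.
  case: gw => [[pw vw]|E|[pu E]|[pu pt E]]; rewrite ?E in mv *.
  + split; first by case: pw => x x0 <-; apply: bp.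
    by move=> i j k; apply: crowd_onto_pebble mv pw vw.
  + split; first by rewrite /inward /=; case: ifP; lia.
    by move=> i j k; apply: crowd_inward mv vN.
  + by split=> // i j k; apply: crowd_across mv vN pu.
  split; last by move=> i j k; case: (crowd_outward i j k Cp mv vN pu pt l0 lv).
  have [vN' _] := crowd_outward l l l Cp mv vN pu pt l0 lv.
  by rewrite /outward /=; case: ifP; lia.
split=> //; first by rewrite p0w; apply: leqW.
by move=> i i0; case: (mv i i0) => [->|[_ ->//]]; apply: bp.
Qed.

End Patrol.

(** * The guided implementation *)

Section Play.

Variables (m : nat) (A : collective m) (p0 : config m).
Implicit Types (p : config m) (v w : vertex).

(** If no candidate matches, [find] returns the length of [c] and [nth] its default [v], so [A_1]
    stays, as [obeys] demands. *)
Definition target p (y : output 'I_m.+1) : vertex :=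
  let v := p ord0 in
  let c := [:: inward v; across v; outward v] in
  if y is Some s then nth v c (find (fun u => occupants p u == s) c) else v.

Lemma target_obeys p y : obeys p (p ord0) y (target p y).
Proof.
case: y => [s|]; last exact: eqxx.
rewrite /obeys -(eq_has_r (mem_candidates (p ord0))) /target.
set c := [:: _; _; _].
case: ifP => Hs; last by rewrite hasNfind ?Hs // nth_default.
rewrite -(mem_candidates (p ord0)) mem_nth -?has_find //=.
exact: (nth_find (p ord0) Hs).
Qed.

Lemma occupied_pebbled p u :
  u != p ord0 -> occupants p u != set0 -> pebbled p u.
Proof.
move=> uv /set0Pn[l]; rewrite inE => /eqP lu; exists l => //.
by apply: contra uv => /eqP <-; rewrite lu.
Qed.

(** If [s] is nonempty, a target other than [v] carries a pebble; if [s] is empty, every candidate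
    passed over does. *)
Lemma target_guided p y :
  guided p (p ord0) (target p y) \/ target p y = p ord0.
Proof.
case: y => [s|]; last by right.
have away u : 0 < vdist (p ord0) u -> u != p ord0.
  by apply: contraTneq => ->; rewrite vdistvv.
have di : vdist (p ord0) (inward (p ord0)) = 1.
  by rewrite /vdist /inward /=; case: ifP; lia.
have da : vdist (p ord0) (across (p ord0)) = 1.
  by rewrite /vdist /across /=; have := ltn_ord (p ord0).2; lia.
have dou : vdist (p ord0) (outward (p ord0)) = 1.
  by rewrite /vdist /outward /=; case: ifP; lia.
have occ u : vdist (p ord0) u = 1 -> occupants p u != set0 -> pebbled p u.
  by move=> du; apply/occupied_pebbled/away; rewrite du.
rewrite /target /=; case: ifP => [_|/negbT Hi]; first by left; constructor 2.
case: ifP => [/eqP sa|/negbT Ha] /=.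
  left; have [s0|s0] := eqVneq s set0; last first.
    by constructor 1; split=> //; apply: occ; rewrite ?sa.
  by constructor 3; split=> //; apply: occ; rewrite // -s0.
case: ifP => [/eqP so|_] /=; last by right.
left; have [s0|s0] := eqVneq s set0; last first.
  by constructor 1; split=> //; apply: occ; rewrite ?so.
by constructor 4; split=> //; apply: occ; rewrite // -s0.
Qed.

Definition advance (c : config m * forall i, state (A i)) :
    config m * forall i, state (A i) :=
  let y i := out (c.2 i) (view c.1 (c.1 i)) in
  let w := target c.1 (y ord0) in
  (fun j => if (j == ord0) || (y j != None) && (y j == y ord0)
            then w else c.1 j,
   fun i => trans (c.2 i) (view c.1 (c.1 i))).

Definition play t := iter t advance (p0, fun i => init (A i)).

Definition patrol := Run (fun t => (play t).1) (fun t => (play t).2).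

Lemma patrol_implementation : implementation p0 patrol.
Proof.
split=> // t; split=> [//||j j0]; last first.
  by rewrite /= (negbTE j0).
exact: target_obeys.
Qed.

Lemma patrol_carries t : type1 A ->
  carries (pos patrol t) (pos patrol t.+1)
    (pos patrol t ord0) (pos patrol t.+1 ord0).
Proof.
move=> tA j j0; have [card1 moves] := tA j j0.
have [_ _ /(_ t)[_ _ /(_ j j0) ->]] := patrol_implementation.
case: ifP => [/andP[Hy /eqP E]|_]; [right; split=> //|by left].
move: Hy; rewrite /output_at; case Ey: (out _ _) => [s|//] _.
(* Having a single state, the pebble is in its initial one, to which [type1] applies. *)
have Eq : st patrol t j = init (A j).
  by apply: (card_le1_eqP (A := predT)) => //; rewrite card1.
by move: Ey; rewrite Eq => /moves[]; rewrite /members_here /= inE => /eqP.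
Qed.

Lemma patrol_confined N t : m <= 3 -> 4 < N -> type1 A -> confined N p0 ->
  confined N (pos patrol t).
Proof.
move=> m3 N4 tA Cp; elim: t => [//|t IH].
have mv := @patrol_carries t tA.
have [|E] := target_guided (pos patrol t) (output_at patrol t ord0).
  by move=> gw; apply: confined_step IH gw _ mv.
have E0 : pos patrol t.+1 ord0 = pos patrol t ord0 by rewrite -[RHS]E.
have fixed i : pos patrol t.+1 i = pos patrol t i.
  have [->|i0] := eqVneq i ord0; first exact: E0.
  by case: (mv i i0) => // -[-> ->].
have [a1 bp cp] := IH.
split=> [|i i0|i j k]; rewrite !fixed //; [exact: bp|exact: cp].
Qed.

End Play.

Local Open Scope ring_scope.

(** * Confined movements are not directed *)

Lemma coordinate_bound (m : nat) (p : config m) (n : nat) :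
  (forall i, (`|(p i).1| <= n)%N) -> `|(coordinate p).1| <= n%:R.
Proof.
move=> pn; rewrite /coordinate /= normrM normfV [`|m.+1%:R|]ger0_norm ?ler0n //.
rewrite ler_pdivrMr ?ltr0n // -natrM.
apply: le_trans (ler_norm_sum _ _ _) _.
apply: le_trans (_ : \sum_(i < m.+1) n%:R <= _).
  by apply: ler_sum => i _; rewrite -intr_norm -abszE ler_nat.
by rewrite sumr_const card_ord natrM mulr_natr.
Qed.

Theorem theorem1 :
  forall (m : nat) (A : collective m) (p0 : config m),
    (m <= 3)%N -> type1 A ->
    exists r : run A, implementation p0 r /\ ~ directed (pos r).
Proof.
move=> m A p0 m3 tA; exists (patrol A p0); split.
  exact: patrol_implementation.
(* The summand 5 ensures [4 < N] and puts all initial columns strictly within [N], so that the crowd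
   condition holds at the start. *)
pose N := (\max_i `|(p0 i).1|%N + 5)%N.
have N0 i : (`|(p0 i).1| < N)%N.
  rewrite /N addnS ltnS; apply: leq_trans (leq_addr _ _).
  exact: (leq_bigmax i).
have N4 : (4 < N)%N by rewrite /N !addnS !ltnS.
have Cp : confined N p0.
  by split=> [|i _|i j k _ _ _ //]; apply/ltnW => //; apply: leqW.
have bnd t : `|(coordinate (pos (patrol A p0) t)).1| <= N.+1%:R.
  apply: coordinate_bound => i.
  have [a bp _] := patrol_confined t m3 N4 tA Cp.
  have [->//|i0] := eqVneq i ord0.
  by apply/leqW/bp.
(* Both coordinates are at most [N.+1] in absolute value, so no displacement exceeds twice that. *)
move=> [c1 [c2 [_ _ /(_ (N.+1 + N.+1)%N)[t]]]].
rewrite ltNge natrD => /negP; apply.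
by apply: le_trans (ler_normB _ _) _; apply: lerD.
Qed.
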